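(* Let $F_A$ be the free group with finite basis $A$. The subgroup intersection problem for $F_A$ is solvable: there exists an algorithm which, given two finite families of words $u_1,\ldots,u_k$ and $v_1,\ldots,v_l$ in $A^{\pm}=A\sqcup A^{-1}$, decides whether the intersection $\langle u_1,\ldots,u_k\rangle\cap\langle v_1,\ldots,v_l\rangle$ of the corresponding subgroups of $F_A$ is finitely generated and, if so, computes a generating set for it.
   Context: $A^{-1}$ denotes the set of formal inverses of the letters in $A$. Words in $A^{\pm}$ represent elements of $F_A$ in the usual way. *)

(* Defs.v *)
From HB Require Import structures.
From mathcomp Require Import all_boot.

Set Implicit Arguments.
Unset Strict Implicit.
Unset Printing Implicit Defensive.

(* The alphabet A^{+-}: [inl a] is the letter a, [inr a] its formal inverse. *)
Definition letter (A : Type) : Type := (A + A)%type.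
Definition word (A : Type) : Type := seq (letter A).


Section FreeGroup.
Variable A : choiceType.
Implicit Types (x y : letter A) (u v w : word A).

Definition linv x : letter A :=
  match x with inl a => inr a | inr a => inl a end.

Definition reduced w : bool := sorted [rel x y | y != linv x] w.

Definition push x w : word A :=
  if w is y :: w' then if y == linv x then w' else x :: w else [:: x].

Definition reduce w : word A := foldr push [::] w.

Definition winv w : word A := rev (map linv w).

Lemma linvK : involutive linv. Proof. by case. Qed.

Lemma reduced_push x w : reduced w -> reduced (push x w).
Proof.
case: w => [|y w] //= yw; case: eqP => [_|/eqP xy]; first exact: path_sorted yw.
by rewrite /reduced /= xy.
Qed.

Lemma foldr_push_reduced u w : reduced w -> reduced (foldr push w u).
Proof. by move=> rw; elim: u => //= x u; apply: reduced_push. Qed.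

Lemma reduce_reduced w : reduced (reduce w).
Proof. exact: foldr_push_reduced. Qed.

Lemma reduce_id w : reduced w -> reduce w = w.
Proof.
rewrite /reduced /reduce; elim: w => //= x w IH xw.
rewrite {}IH; last exact: path_sorted xw.
by case: w xw => //= y w /andP[/negPf-> _].
Qed.

Lemma pushK x w : reduced w -> push (linv x) (push x w) = w.
Proof.
case: w => [|y w] /=; first by rewrite linvK eqxx.
case: eqP => [-> | _ _]; last by rewrite /= linvK eqxx.
case: w => [|z w] //=; rewrite /reduced /= linvK => /andP[zx _].
by rewrite (negPf zx).
Qed.

Lemma foldr_push_reduce u w : reduced w ->
  foldr push w (reduce u) = foldr push w u.
Proof.
move=> rw; elim: u => //= x u <-.
case: (reduce u) => //= y r; case: eqP => // ->.
by rewrite -{1}[x]linvK pushK ?foldr_push_reduced.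
Qed.

Lemma reduce_cat u v : reduce (u ++ v) = foldr push (reduce v) u.
Proof. by rewrite /reduce foldr_cat. Qed.

Lemma winvK : involutive winv.
Proof. by move=> w; rewrite /winv map_rev revK (mapK linvK). Qed.

Lemma winv_reduced w : reduced w -> reduced (winv w).
Proof.
rewrite /reduced /winv rev_sorted sorted_map; apply: sub_sorted => x y /=.
by rewrite linvK eq_sym.
Qed.

Lemma reduce_winvl w : reduce (winv w ++ w) = [::].
Proof.
elim: w => // x w IH; rewrite /winv map_cons rev_cons cat_rcons.
by rewrite reduce_cat /= pushK ?reduce_reduced // -reduce_cat.
Qed.

(* The group F_A, realised on the reduced words. *)
Record free_group := FreeGroup { fgval : word A; _ : reduced fgval }.

HB.instance Definition _ := [isSub for fgval].
HB.instance Definition _ := [Choice of free_group by <:].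

Implicit Types g h k : free_group.

Definition fg_one := @FreeGroup [::] isT.
Definition fg_mul g h := FreeGroup (reduce_reduced (fgval g ++ fgval h)).
Definition fg_inv g := FreeGroup (winv_reduced (valP g)).

Fact fg_mulA : associative fg_mul.
Proof.
move=> g h k; apply: val_inj => /=.
rewrite (reduce_cat (reduce _)) foldr_push_reduce ?reduce_reduced //.
by rewrite -reduce_cat -catA !(reduce_cat (fgval g)) reduce_id ?reduce_reduced.
Qed.

Fact fg_mul1 : left_id fg_one fg_mul.
Proof. by move=> g; apply: val_inj; rewrite /= reduce_id ?(valP g). Qed.

Fact fg_mulr1 : right_id fg_one fg_mul.
Proof. by move=> g; apply: val_inj; rewrite /= cats0 reduce_id ?(valP g). Qed.

Fact fg_mulV : left_inverse fg_one fg_inv fg_mul.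
Proof. by move=> g; apply: val_inj; rewrite /= reduce_winvl. Qed.

Fact fg_mulrV : right_inverse fg_one fg_inv fg_mul.
Proof.
by move=> g; apply: val_inj; rewrite /= -{1}[fgval g]winvK reduce_winvl.
Qed.

HB.instance Definition _ :=
  isGroup.Build free_group fg_mulA fg_mul1 fg_mulr1 fg_mulV fg_mulrV.

Definition fg_basis (a : A) : free_group := @FreeGroup [:: inl a] isT.

Definition letter_elt x : free_group :=
  match x with inl a => fg_basis a | inr a => ((fg_basis a)^-1)%g end.

Definition word_elt w : free_group := (\prod_(x <- w) letter_elt x)%g.

End FreeGroup.

(* Subsets of a (possibly infinite) group G are predicates G -> Prop. *)
Inductive generated (G : groupType) (s : seq G) : G -> Prop :=
| generated_in x of x \in s : generated s x
| generated1 : generated s 1%g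
| generatedM x y of generated s x & generated s y : generated s (x * y)%g
| generatedV x of generated s x : generated s (x^-1)%g.

Definition finitely_generated (G : groupType) (H : G -> Prop) : Prop :=
  exists s : seq G, forall x, H x <-> generated s x.

Definition subgroup_of_words (A : choiceType) (us : seq (word A)) :
  free_group A -> Prop := generated (map (@word_elt A) us).

(* Programs for Kleene partial recursive functions: [eval p xs y] states that
   p halts on input xs with output y. *)
Inductive prog : Type :=
| Zero
| Succ
| Proj of nat
| Comp of prog & seq prog
| Rec of prog & prog
| Mu of prog.

Inductive eval : prog -> seq nat -> nat -> Prop :=
| eval_Zero xs : eval Zero xs 0
| eval_Succ x : eval Succ [:: x] x.+1
| eval_Proj i xs of i < size xs : eval (Proj i) xs (nth 0 xs i)
| eval_Comp p qs xs ys y of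
    evals qs xs ys & eval p ys y : eval (Comp p qs) xs y
| eval_Rec0 p q xs y of eval p xs y : eval (Rec p q) (0 :: xs) y
| eval_RecS p q n xs z y of
    eval (Rec p q) (n :: xs) z & eval q (n :: z :: xs) y :
    eval (Rec p q) (n.+1 :: xs) y
| eval_Mu p xs n (m : nat -> nat) of
    eval p (n :: xs) 0 & (forall i, i < n -> eval p (i :: xs) (m i).+1) :
    eval (Mu p) xs n
with evals : seq prog -> seq nat -> seq nat -> Prop :=
| evals_nil xs : evals [::] xs [::]
| evals_cons p ps xs y ys of eval p xs y & evals ps xs ys :
    evals (p :: ps) xs (y :: ys).

Scheme eval_mut_ind := Induction for eval Sort Prop
  with evals_mut_ind := Induction for evals Sort Prop.

Lemma eval_functional p xs y y' : eval p xs y -> eval p xs y' -> y = y'.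
Proof.
move=> e; move: y'.
apply: (@eval_mut_ind (fun p xs y _ => forall y', eval p xs y' -> y = y')
  (fun ps xs ys _ => forall ys', evals ps xs ys' -> ys = ys')
  _ _ _ _ _ _ _ _ _ p xs y e) => {p xs y e}.
- by move=> xs y' e; inversion e.
- by move=> x y' e; inversion e.
- by move=> i xs _ y' e; inversion e.
- move=> p qs xs ys y _ IHq _ IHp y' e; inversion e; subst.
  by apply: IHp; rewrite (IHq ys0).
- by move=> p q xs y _ IH y' e; inversion e; subst; apply: IH.
- move=> p q n xs z y _ IHz _ IHy y' e; inversion e; subst.
  by apply: IHy; rewrite (IHz z0).
- move=> p xs n m _ IH0 _ IHm n' e.
  have [e0 em] : eval p (n' :: xs) 0 /\
      (forall i, i < n' -> exists z, eval p (i :: xs) z.+1).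
    by inversion e; subst; split=> // i lt_i; eexists; eauto.
  case: (ltngtP n n') => // lt; last by have := IHm _ lt _ e0.
  by have [z /IH0] := em _ lt.
- by move=> xs ys' e; inversion e.
- move=> p ps xs y ys _ IHp _ IHps ys' e; inversion e; subst.
  by rewrite (IHp y0) // (IHps ys0).
Qed.

(* Goedel numbering of inputs and outputs; [CodeSeq.code] is an effective
   bijection from seq nat to nat. The output 0 means that the intersection is
   not finitely generated. *)
Section Encoding.
Variable A : finType.

Definition code_letter (x : letter A) : nat := enum_rank x.
Definition code_word (w : word A) : nat := CodeSeq.code (map code_letter w).
Definition code_words (ws : seq (word A)) : nat :=
  CodeSeq.code (map code_word ws).
Definition code_output (o : option (seq (word A))) : nat :=
  if o is Some ws then (code_words ws).+1 else 0.

Definition computable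
    (f : seq (word A) -> seq (word A) -> option (seq (word A))) : Prop :=
  exists p : prog, forall us vs : seq (word A),
    eval p [:: code_words us; code_words vs] (code_output (f us vs)).

End Encoding.

(* Main.v *)
Require Import Defs.
From mathcomp Require Import all_boot.
From mathcomp Require Import boolp.

Set Implicit Arguments.
Unset Strict Implicit.
Unset Printing Implicit Defensive.

(* The intersection is always finitely generated (Howson), so only a generating
   set has to be computed. The program searches for the least certificate
   (E1, E2, L, ws, D1, D2) and returns ws: E1 and E2 are finite inverse automata
   reading every u_i, respectively v_i, as a loop at the base point; L assigns to
   the vertices p of the product automaton words t_p with t_base = 1, such that
   t_p x t_q^-1 belongs to ws for every edge p -x-> q; D1 and D2 write each word
   of ws as a product of the u_i^{+-1}, respectively of the v_i^{+-1}.
   An element of the intersection labels a loop of the product automaton, hence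
   is a product of the words t_p x t_q^-1, so a certificate is correct. It exists:
   take for E1 and E2 the Schreier coset graphs, restricted to the cosets of the
   prefixes of the generators. Checking a certificate is primitive recursive. *)

(** * Closure properties of the recursive functions of fixed arity *)

Local Notation code := CodeSeq.code.
Local Notation decode := CodeSeq.decode.

(* The argument list of a program serves as an environment: under a binder it is
   extended on the left, so that the outer variables are reached through drop. *)

Definition recursive k (f : seq nat -> nat) : Prop :=
  exists p, forall s, size s = k -> eval p s (f s).

Definition recursives k (fs : seq (seq nat -> nat)) : Prop :=
  exists ps, forall s, size s = k -> evals ps s [seq f s | f <- fs].

Definition recursiveb k (P : seq nat -> bool) : Prop :=
  recursive k (fun s => P s).

Definition recursivel k (f : seq nat -> seq nat) : Prop :=
  recursive k (fun s => code (f s)).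

Create HintDb rec discriminated.
#[global] Hint Constants Opaque : rec.

Lemma eq_recursive k f g :
  (forall s, f s = g s) -> recursive k f -> recursive k g.
Proof. by move=> eq_fg [p ep]; exists p => s /ep; rewrite eq_fg. Qed.

Lemma recursive_nth k i : i < k -> recursive k (fun s => nth 0 s i).
Proof.
by move=> lt_ik; exists (Proj i) => s sz_s; constructor; rewrite sz_s.
Qed.

Lemma recursives_nil k : recursives k [::].
Proof. by exists [::] => s _; constructor. Qed.

Lemma recursives_cons k f fs :
  recursive k f -> recursives k fs -> recursives k (f :: fs).
Proof.
by move=> [p ep] [ps eps]; exists (p :: ps) => s sz_s; constructor; auto.
Qed.

Lemma recursive_comp k m g fs :
    recursive m g -> size fs = m -> recursives k fs ->
  recursive k (fun s => g [seq f s | f <- fs]).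
Proof.
move=> [p ep] sz_fs [ps eps]; exists (Comp p ps) => s sz_s.
by econstructor; [exact: eps | apply: ep; rewrite size_map].
Qed.

Lemma recursives_Proj k l :
  all (gtn k) l ->
  exists ps, forall s, size s = k -> evals ps s (map (nth 0 s) l).
Proof.
move=> lt_lk; exists (map Proj l) => s sz_s.
elim: l lt_lk => [_|i l IH /andP[lt_ik /IH el]].
  exact: evals_nil.
by constructor => //; constructor; rewrite sz_s.
Qed.

(** Substitution under [j] binders: the values of [hs] replace the [j] innermost variables and
    [drop j] keeps the outer ones. With [hs] empty it is weakening. *)
Lemma recursive_subst j k G hs :
    recursive (size hs + k) G -> recursives (j + k) hs ->
  recursive (j + k) (fun t => G ([seq h t | h <- hs] ++ drop j t)).
Proof.
move=> [p ep] [ps eps].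
have [|qs eqs] := @recursives_Proj (j + k) (iota j k).
  by apply/allP => i; rewrite mem_iota => /andP[].
exists (Comp p (ps ++ qs)) => t sz_t.
have sz_d: size (drop j t) = k by rewrite size_drop sz_t addKn.
apply: (@eval_Comp _ _ _ ([seq h t | h <- hs] ++ drop j t)).
  have {eqs} := eqs t sz_t.
  rewrite map_nth_iota -?size_drop ?sz_d // take_oversize ?sz_d // => eqs.
  have {eps} := eps t sz_t.
  elim: ps [seq h t | h <- hs] => [|q ps' IH] ys e; inversion e; subst => //=.
  by constructor => //; apply: IH.
by apply: ep; rewrite size_cat size_map sz_d.
Qed.

Lemma recursive_iteri k f (G : nat -> nat -> seq nat -> nat) n :
    recursive k n -> recursive k f ->
    recursive k.+2 (fun t => G (nth 0 t 0) (nth 0 t 1) (drop 2 t)) ->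
  recursive k (fun s => iteri (n s) (fun i z => G i z s) (f s)).
Proof.
move=> [pn en] [pf ef] [pG eG].
have [|ps eps] := @recursives_Proj k (iota 0 k).
  by apply/allP => i; rewrite mem_iota => /andP[].
exists (Comp (Rec pf pG) (pn :: ps)) => s sz_s.
apply: (@eval_Comp _ _ _ (n s :: s)).
  constructor; first exact: en.
  by have := eps s sz_s; rewrite -sz_s map_nth_iota0 ?take_size.
elim: (n s) => [|i IH] /=; first by constructor; apply: ef.
econstructor; first exact: IH.
have := eG [:: i, iteri i (fun i z => G i z s) (f s) & s].
by rewrite /= sz_s drop0; apply.
Qed.

Lemma recursive_succ k f : recursive k f -> recursive k (fun s => (f s).+1).
Proof.
move=> rf; apply: (@recursive_comp k 1 (fun t => (nth 0 t 0).+1) [:: f]) => //.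
  by exists Succ => [[|x []]] //= _; constructor.
by apply: recursives_cons rf (recursives_nil _).
Qed.

Lemma recursive_const k n : recursive k (fun=> n).
Proof.
elim: n => [|n IH]; last exact: recursive_succ IH.
by exists Zero => s _; constructor.
Qed.

#[export] Hint Resolve recursive_succ recursive_const : rec.
(* A variable reached through several binders is an [nth] of iterated [drop]s, which collapses to a
   single projection. *)
#[export] Hint Extern 1 (recursive _ (fun _ => nth 0 _ _)) =>
  (eapply eq_recursive;
    [by move=> ?; rewrite ?drop_drop ?nth_drop; reflexivity
    | by apply: recursive_nth]) : rec.

Ltac rec := solve [eauto 50 with rec nocore].

Lemma recursive_add k f g :
  recursive k f -> recursive k g -> recursive k (fun s => f s + g s).
Proof.
move=> rf rg.
apply: (@eq_recursive _ (fun s => iteri (g s) (fun _ z => z.+1) (f s))).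
  by move=> s; elim: (g s) => [|n /= ->]; rewrite ?addn0 ?addnS.
by apply: recursive_iteri => //; rec.
Qed.

Lemma recursive_pred k f : recursive k f -> recursive k (fun s => (f s).-1).
Proof.
move=> rf; apply: (@eq_recursive _ (fun s => iteri (f s) (fun i _ => i) 0)).
  by move=> s; case: (f s).
by apply: recursive_iteri => //; rec.
Qed.
#[export] Hint Resolve recursive_add recursive_pred : rec.

Lemma recursive_sub k f g :
  recursive k f -> recursive k g -> recursive k (fun s => f s - g s).
Proof.
move=> rf rg.
apply: (@eq_recursive _ (fun s => iteri (g s) (fun _ z => z.-1) (f s))).
  by move=> s; elim: (g s) => [|n /= ->]; rewrite ?subn0 ?subnS.
by apply: recursive_iteri => //; rec.
Qed.
#[export] Hint Resolve recursive_sub : rec.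

Lemma recursiveb_eq k f g :
  recursive k f -> recursive k g -> recursiveb k (fun s => f s == g s).
Proof.
move=> rf rg.
apply: (@eq_recursive _ (fun s => 1 - ((f s - g s) + (g s - f s)))); last by rec.
by move=> s; rewrite eqn_leq -!subn_eq0 -addn_eq0; case: (_ + _).
Qed.

Lemma recursive_if k P f g : recursiveb k P -> recursive k f ->
  recursive k g -> recursive k (fun s => if P s then f s else g s).
Proof.
move=> rP rf rg.
apply: (@eq_recursive _ (fun s => iteri (P s) (fun _ _ => f s) (g s))).
  by move=> s; case: (P s).
apply: (@recursive_iteri _ _ (fun _ _ s => f s)) => //.
exact: (@recursive_subst 2 _ _ [::]) rf (recursives_nil _).
Qed.
#[export] Hint Resolve recursiveb_eq recursive_if : rec.

Lemma recursiveb_const k b : recursiveb k (fun=> b).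
Proof. exact: recursive_const. Qed.

Lemma recursiveb_if k P Q R : recursiveb k P -> recursiveb k Q ->
  recursiveb k R -> recursiveb k (fun s => if P s then Q s else R s).
Proof.
move=> rP rQ rR.
apply: (@eq_recursive _ (fun s => if P s then Q s : nat else R s)).
  by move=> s; case: (P s).
exact: recursive_if.
Qed.
#[export] Hint Resolve recursiveb_const recursiveb_if : rec.

Lemma recursiveb_and k P Q :
  recursiveb k P -> recursiveb k Q -> recursiveb k (fun s => P s && Q s).
Proof. by move=> rP rQ; apply: recursiveb_if => //; rec. Qed.

Lemma recursiveb_or k P Q :
  recursiveb k P -> recursiveb k Q -> recursiveb k (fun s => P s || Q s).
Proof. by move=> rP rQ; apply: recursiveb_if => //; rec. Qed.

Lemma recursiveb_neg k P : recursiveb k P -> recursiveb k (fun s => ~~ P s).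
Proof. by move=> rP; apply: recursiveb_if => //; rec. Qed.
#[export] Hint Resolve recursiveb_and recursiveb_or recursiveb_neg : rec.

Lemma recursiveb_all k (P : nat -> seq nat -> bool) n : recursive k n ->
    recursiveb k.+1 (fun t => P (nth 0 t 0) (drop 1 t)) ->
  recursiveb k (fun s => all (fun i => P i s) (iota 0 (n s))).
Proof.
move=> rn rP.
pose f i z s : nat := (z != 0) && P i s.
apply: (@eq_recursive _ (fun s => iteri (n s) (fun i z => f i z s) 1)).
  move=> s; elim: (n s) => // m IH.
  by rewrite -[in RHS]addn1 iotaD all_cat /= IH /f andbT; case: all.
apply: (@recursive_iteri _ _ f) => //; first by rec.
apply: (@recursiveb_and _ (fun t => nth 0 t 1 != 0)); first by rec.
pose G t := P (nth 0 t 0) (drop 1 t) : nat.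
(* [P] does not see the accumulator, so variable 1 is removed from the environment. *)
apply: (@eq_recursive _ (fun t => G ([:: nth 0 t 0] ++ drop 2 t))).
  by move=> t; rewrite /G /= drop0.
apply: (@recursive_subst 2 _ G [:: fun t => nth 0 t 0]) => //.
by apply: recursives_cons (recursives_nil _); rec.
Qed.

Lemma recursiveb_has k (P : nat -> seq nat -> bool) n : recursive k n ->
    recursiveb k.+1 (fun t => P (nth 0 t 0) (drop 1 t)) ->
  recursiveb k (fun s => has (fun i => P i s) (iota 0 (n s))).
Proof.
move=> rn rP.
apply: (@eq_recursive _ (fun s => ~~ all (fun i => ~~ P i s) (iota 0 (n s)))).
  move=> s; rewrite -has_predC; congr nat_of_bool.
  by apply: eq_has => i /=; rewrite negbK.
by apply/recursiveb_neg/(@recursiveb_all _ (fun i s => ~~ P i s)) => //; rec.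
Qed.

Lemma recursive_comp1 k g f : recursive 1 (fun t => g (nth 0 t 0)) ->
  recursive k f -> recursive k (fun s => g (f s)).
Proof.
move=> rg rf; apply: (@recursive_comp _ 1 _ [:: f] rg) => //.
by apply: recursives_cons rf (recursives_nil _).
Qed.

Lemma recursive_comp2 k g f1 f2 :
    recursive 2 (fun t => g (nth 0 t 0) (nth 0 t 1)) ->
  recursive k f1 -> recursive k f2 -> recursive k (fun s => g (f1 s) (f2 s)).
Proof.
move=> rg rf1 rf2; apply: (@recursive_comp _ 2 _ [:: f1; f2] rg) => //.
exact: recursives_cons rf1 (recursives_cons rf2 (recursives_nil _)).
Qed.

(** Bounded search: the loop keeps the last index satisfying [P], and only [a] satisfies it. This
    serves to invert the coding of lists. *)
Lemma iteri_search (P : pred nat) n a : a < n -> {in gtn n, P =1 pred1 a} ->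
  iteri n (fun i z => if P i then i else z) 0 = a.
Proof.
move=> lt_an Pa; elim: n => // n IH in lt_an Pa *.
rewrite /= Pa ?inE //=; case: eqVneq => // ne_na.
apply: IH => [|i lt_in]; first by rewrite ltn_neqAle eq_sym ne_na -ltnS.
by apply: Pa; rewrite inE ltnW.
Qed.

(** * Recursive operations on lists coded as numbers *)

Lemma recursivel_decode k f :
  recursive k f -> recursivel k (fun s => decode (f s)).
Proof. by apply: eq_recursive => s; rewrite CodeSeq.decodeK. Qed.

Lemma recursive_code k f :
  recursivel k f -> recursive k (fun s => code (f s)).
Proof. by []. Qed.

Lemma recursivel_nil k : recursivel k (fun=> [::]).
Proof. exact: recursive_const. Qed.

Lemma recursivel_cons k f g :
  recursive k f -> recursivel k g -> recursivel k (fun s => f s :: g s).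
Proof.
move=> rf rg; pose c s := code (g s).
have rc: recursive k c by [].
(* The code of [x :: l] is 2 ^ x * (2 * code l + 1), obtained by doubling x times. *)
apply: (@eq_recursive _ (fun s => iteri (f s) (fun _ z => z + z) (c s + c s).+1)).
  move=> s; rewrite /c /= addnn; elim: (f s) => [|n /= ->].
    by rewrite mul1n.
  by rewrite expnS -mulnA mul2n addnn.
by apply: recursive_iteri => //; rec.
Qed.
#[export] Hint Resolve recursivel_decode recursive_code : rec.
#[export] Hint Resolve recursivel_nil recursivel_cons : rec.

(** This allows a loop over [l] to run [code l] times. *)
Lemma size_code l : size l <= code l.
Proof.
elim: l => //= x l IH; apply: (@leq_trans (code l).*2.+1).
  by rewrite ltnS (leq_trans IH) // -addnn leq_addr.
by rewrite leq_pmull ?expn_gt0.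
Qed.

Lemma ltn_code_tail x l : code l < code (x :: l).
Proof.
apply: (@leq_trans (code l).*2.+1); first by rewrite ltnS -addnn leq_addr.
by rewrite /= leq_pmull ?expn_gt0.
Qed.

(** The code of a nonempty list exceeds both its head and the code of its tail, so either is found
    by bounded search. For the empty list the search range is empty and the default 0 is right. *)
Lemma recursive_head k l :
  recursivel k l -> recursive k (fun s => head 0 (l s)).
Proof.
pose P n i := has (fun j => n == code (i :: decode j)) (iota 0 n).
pose h n := iteri n (fun i z => if P n i then i else z) 0.
move=> rl; apply: (@eq_recursive _ (fun s => h (code (l s)))); last first.
  apply: (@recursive_comp1 _ h) => //; apply: recursive_iteri; try rec.
  apply: recursive_if; [|rec|rec].
  apply: (@recursiveb_has _
    (fun j t => nth 0 (drop 2 t) 0 == code (nth 0 t 0 :: decode j))); rec.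
move=> s; case: (l s) => // x w; apply: iteri_search.
  by have /andP[] := CodeSeq.ltn_code (x :: w).
move=> i _; apply/hasP/eqP => [[j _ /eqP/(can_inj CodeSeq.codeK)[]] //| -> {i}].
by exists (code w); rewrite ?CodeSeq.codeK // mem_iota ltn_code_tail.
Qed.

Lemma recursivel_behead k l :
  recursivel k l -> recursivel k (fun s => behead (l s)).
Proof.
pose P n j := has (fun i => n == code (i :: decode j)) (iota 0 n).
pose h n := iteri n (fun j z => if P n j then j else z) 0.
move=> rl; apply: (@eq_recursive _ (fun s => h (code (l s)))); last first.
  apply: (@recursive_comp1 _ h) => //; apply: recursive_iteri; try rec.
  apply: recursive_if; [|rec|rec].
  apply: (@recursiveb_has _
    (fun i t => nth 0 (drop 2 t) 0 == code (i :: decode (nth 0 t 0)))); rec.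
move=> s; case: (l s) => // x w; apply: iteri_search.
  exact: ltn_code_tail.
move=> j _; apply/hasP/eqP => [[i _ /eqP/(can_inj CodeSeq.codeK)[_ ->]] | -> {j}].
  by rewrite CodeSeq.decodeK.
exists x; rewrite ?CodeSeq.codeK // mem_iota.
by have /andP[] := CodeSeq.ltn_code (x :: w).
Qed.
#[export] Hint Resolve recursive_head recursivel_behead : rec.

Lemma recursivel_drop k i l : recursive k i -> recursivel k l ->
  recursivel k (fun s => drop (i s) (l s)).
Proof.
move=> ri rl.
pose f i l := iteri i (fun _ z => code (behead (decode z))) l.
apply: (@eq_recursive _ (fun s => f (i s) (code (l s)))).
  move=> s; elim: (i s) => [|j /= ->]; first by rewrite drop0.
  by rewrite CodeSeq.codeK -drop1 drop_drop.
apply: (@recursive_comp2 _ f) => //; apply: recursive_iteri; rec.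
Qed.
#[export] Hint Resolve recursivel_drop : rec.

Lemma recursive_nth_seq k i l : recursivel k l -> recursive k i ->
  recursive k (fun s => nth 0 (l s) (i s)).
Proof.
move=> rl ri.
apply: (@eq_recursive _ (fun s => head 0 (drop (i s) (l s)))); last by rec.
by move=> s; rewrite -nth0 nth_drop addn0.
Qed.
#[export] Hint Resolve recursive_nth_seq : rec.

(** Only the empty list has code 0, so the test says that i is still inside [l]. The iterations past
    the end do nothing, and any bound on the size will do. *)
Lemma foldl_iteri (T : Type) (g : T -> nat -> T) z l n : size l <= n ->
  iteri n (fun i a => if code (drop i l) != 0 then g a (nth 0 l i) else a) z
    = foldl g z l.
Proof.
move=> le_ln; rewrite -[in RHS](take_oversize le_ln).
elim: n {le_ln} => [|n IH] /=; first by rewrite take0.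
case: (ltnP n (size l)) => [lt_nl | le_ln]; last first.
  by rewrite drop_oversize //= IH !take_oversize // ltnW.
rewrite (take_nth 0) // -cats1 foldl_cat IH (drop_nth 0) //=.
by rewrite muln_eq0 expn_eq0.
Qed.

Lemma recursive_foldl k (g : nat -> nat -> seq nat -> nat) z l :
    recursivel k l -> recursive k z ->
    recursive k.+2 (fun t => g (nth 0 t 0) (nth 0 t 1) (drop 2 t)) ->
  recursive k (fun s => foldl (fun a x => g a x s) (z s) (l s)).
Proof.
move=> rl rz rg.
pose f i a s :=
  if code (drop i (l s)) != 0 then g a (nth 0 (l s) i) s else a.
apply: (@eq_recursive _ (fun s => iteri (code (l s)) (fun i a => f i a s) (z s))).
  by move=> s; apply: (foldl_iteri (fun a x => g a x s)); apply: size_code.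
apply: recursive_iteri => //.
have rl2: recursivel k.+2 (fun t => l (drop 2 t)).
  exact: (@recursive_subst 2 _ _ [::]) rl (recursives_nil _).
apply: recursive_if; [rec | | rec].
pose G t := g (nth 0 t 0) (nth 0 t 1) (drop 2 t).
pose h t := nth 0 (l (drop 2 t)) (nth 0 t 0).
(* The loop binds the counter and the accumulator, whereas [g] takes the accumulator and the element
   at the counter. *)
apply: (@eq_recursive _ (fun t => G ([:: nth 0 t 1; h t] ++ drop 2 t))).
  by move=> t; rewrite /G /= drop0.
apply: (@recursive_subst 2 _ G [:: fun t => nth 0 t 1; h]) => //.
by apply: recursives_cons (recursives_cons _ (recursives_nil _)); rec.
Qed.

Lemma recursivel_foldl k (g : seq nat -> nat -> seq nat -> seq nat) z l :
    recursivel k l -> recursivel k z ->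
    recursivel k.+2
      (fun t => g (decode (nth 0 t 0)) (nth 0 t 1) (drop 2 t)) ->
  recursivel k (fun s => foldl (fun a x => g a x s) (z s) (l s)).
Proof.
move=> rl rz rg; pose g' a x s := code (g (decode a) x s).
apply: (@eq_recursive _ (fun s => foldl (fun a x => g' a x s) (code (z s)) (l s))).
  by move=> s; elim: (l s) (z s) => //= x w IH a; rewrite -IH /g' CodeSeq.codeK.
exact: recursive_foldl.
Qed.

Lemma recursivel_rev k l : recursivel k l -> recursivel k (fun s => rev (l s)).
Proof.
move=> rl.
apply: (@eq_recursive _ (fun s => code (foldl (fun a x => x :: a) [::] (l s)))).
  move=> s; congr code; rewrite -[RHS]cats0 -catrevE.
  by elim: (l s) [::] => //= x w IH a.
by apply: recursivel_foldl; rec.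
Qed.

Lemma recursivel_cat k l1 l2 : recursivel k l1 -> recursivel k l2 ->
  recursivel k (fun s => l1 s ++ l2 s).
Proof.
move=> rl1 rl2; pose f a (x : nat) := x :: a.
apply: (@eq_recursive _ (fun s => code (foldl f (l2 s) (rev (l1 s))))).
  by move=> s; rewrite foldl_rev; congr code; elim: (l1 s) => //= x l ->.
by apply: recursivel_foldl => //; [apply: recursivel_rev | rewrite /f; rec].
Qed.

Lemma recursivel_foldr k (g : nat -> seq nat -> seq nat -> seq nat) z l :
    recursivel k l -> recursivel k z ->
    recursivel k.+2
      (fun t => g (nth 0 t 1) (decode (nth 0 t 0)) (drop 2 t)) ->
  recursivel k (fun s => foldr (fun x a => g x a s) (z s) (l s)).
Proof.
move=> rl rz rg.
apply: (@eq_recursive _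
  (fun s => code (foldl (fun a x => g x a s) (z s) (rev (l s))))).
  by move=> s; rewrite foldl_rev.
apply: (@recursivel_foldl _ (fun a x s => g x a s)) => //.
exact: recursivel_rev.
Qed.
#[export] Hint Resolve recursivel_rev recursivel_cat : rec.

(** The values below [N] are tabulated by nested case distinctions. The inversion of letter codes is
    of this kind. *)
Lemma recursive_finite_support N f : (forall n, N <= n -> f n = n) ->
  recursive 1 (fun t => f (nth 0 t 0)).
Proof.
elim: N f => [|N IH] f fid.
  by apply: (@eq_recursive _ (fun t => nth 0 t 0)) => [s|]; [rewrite fid | rec].
pose g n := if n == N then n else f n.
apply: (@eq_recursive _ (fun t => if nth 0 t 0 == N then f N else g (nth 0 t 0))).
  by move=> s; rewrite /g; case: eqVneq => // ->.
apply: recursive_if; [rec | rec | apply: IH => n le_Nn].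
rewrite /g; case: eqVneq => // ne_nN.
by apply: fid; rewrite ltn_neqAle eq_sym ne_nN.
Qed.

(** * Words read by inverse automata *)

Section Words.
Variable A : choiceType.
Implicit Types (x : letter A) (u v w : word A) (g h : free_group A).
Local Open Scope group_scope.

Lemma word_elt_cat u v : word_elt (u ++ v) = word_elt u * word_elt v.
Proof. exact: big_cat. Qed.

Lemma word_elt_cons x w : word_elt (x :: w) = letter_elt x * word_elt w.
Proof. exact: big_cons. Qed.

Lemma word_elt_nil : word_elt [::] = 1 :> free_group A.
Proof. exact: big_nil. Qed.

Lemma letter_eltV x : letter_elt (linv x) = (letter_elt x)^-1.
Proof. by case: x => a //=; rewrite invgK. Qed.

Lemma word_eltV w : word_elt (winv w) = (word_elt w)^-1.
Proof.
elim: w => [|x w IH]; first by rewrite word_elt_nil invg1.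
rewrite /winv map_cons rev_cons -cats1 word_elt_cat [word_elt (rev _)]IH.
by rewrite !word_elt_cons word_elt_nil mulg1 letter_eltV invgM.
Qed.

Lemma fgval_letter_elt x : fgval (letter_elt x) = [:: x].
Proof. by case: x. Qed.

Lemma fgval_word_elt w : fgval (word_elt w) = reduce w.
Proof.
elim: w => [|x w IH]; first by rewrite word_elt_nil.
rewrite word_elt_cons.
have ->: fgval (letter_elt x * word_elt w)
    = reduce (fgval (letter_elt x) ++ fgval (word_elt w)) by [].
by rewrite fgval_letter_elt IH reduce_cat /= reduce_id ?reduce_reduced.
Qed.

Lemma word_eltK g : word_elt (fgval g) = g.
Proof. by apply: val_inj; rewrite /= fgval_word_elt reduce_id ?(valP g). Qed.

Section Run.

(* A finite partial automaton on the states 1, 2, ...: the value 0 of the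
   transition function means that the transition is undefined. *)
Definition inverse_automaton (d : nat -> letter A -> nat) : Prop :=
  forall p x, d p x != 0%N -> p != 0%N /\ d (d p x) (linv x) = p.

Variable d : nat -> letter A -> nat.
Hypothesis d_inv : inverse_automaton d.

Lemma run0 w : foldl d 0%N w = 0%N.
Proof.
elim: w => //= x w; suff ->: d 0%N x = 0%N by [].
by apply/eqP/contraT => /d_inv[].
Qed.

(** A cancelled pair x x^-1 leads back to the state where it began. The run on [w] has to be
    defined, as [reduce w] may be readable where [w] is not. *)
Lemma run_reduce w p : foldl d p w != 0%N -> foldl d p (reduce w) = foldl d p w.
Proof.
elim: w p => //= x w IH p rpw; rewrite -IH // /push.
have dpx: d p x != 0%N by apply: contraNneq rpw => ->; rewrite run0.
case: (reduce w) => //= y v; case: eqP => //= ->.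
by have [_ ->] := d_inv dpx.
Qed.

Lemma run_winv w p : foldl d p w != 0%N -> foldl d (foldl d p w) (winv w) = p.
Proof.
elim: w p => //= x w IH p rpw; rewrite /winv map_cons rev_cons foldl_rcons.
have dpx: d p x != 0%N by apply: contraNneq rpw => ->; rewrite run0.
by rewrite [foldl _ _ (rev _)]IH //; have [_ ->] := d_inv dpx.
Qed.

Lemma run_generated (us : seq (word A)) g :
    (forall u, u \in us -> foldl d 1%N u = 1%N) ->
  subgroup_of_words us g -> foldl d 1%N (fgval g) = 1%N.
Proof.
move=> loop; elim=> [_ /mapP[u /loop ru ->]||h k _ IHh _ IHk|h _ IHh] //.
- by rewrite fgval_word_elt run_reduce ru.
- have ->: fgval (h * k) = reduce (fgval h ++ fgval k) by [].
  by rewrite run_reduce foldl_cat IHh IHk.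
- have ->: fgval h^-1 = winv (fgval h) by [].
  by have := @run_winv (fgval h) 1%N; rewrite IHh; apply.
Qed.

End Run.

(* [T p] is a representative of the paths from the base point (1, 1) to the
   vertex p of the product automaton. *)
Lemma product_generated (d1 d2 : nat -> letter A -> nat)
    (T : nat -> nat -> option (free_group A)) (G : free_group A -> Prop) :
    inverse_automaton d1 -> inverse_automaton d2 ->
    G 1 -> (forall g h, G g -> G h -> G (g * h)) ->
    T 1%N 1%N = Some 1 ->
    (forall p1 p2 x t, T p1 p2 = Some t -> d1 p1 x != 0%N -> d2 p2 x != 0%N ->
      exists2 t', T (d1 p1 x) (d2 p2 x) = Some t' & G (t * letter_elt x * t'^-1)) ->
  forall w, foldl d1 1%N w = 1%N -> foldl d2 1%N w = 1%N -> G (word_elt w).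
Proof.
move=> d1_inv d2_inv G1 GM T1 Tx.
(* The start vertex is arbitrary for the induction on [w]: the first edge contributes t_p x t_q^-1,
   and its last factor cancels against the t_q of the rest. *)
suff gen w p1 p2 t : T p1 p2 = Some t -> foldl d1 p1 w != 0%N ->
    foldl d2 p2 w != 0%N ->
    exists2 t', T (foldl d1 p1 w) (foldl d2 p2 w) = Some t'
      & G (t * word_elt w * t'^-1).
  move=> w r1 r2; have [||t'] := gen w _ _ _ T1; rewrite ?r1 ?r2 //.
  by rewrite T1 => -[<-]; rewrite mul1g invg1 mulg1.
elim: w p1 p2 t => [|x w IH] p1 p2 t Tp r1 r2 /=.
  by exists t; rewrite // word_elt_nil mulg1 mulgV.
have dx1: d1 p1 x != 0%N by apply: contraNneq r1 => /= ->; rewrite run0.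
have dx2: d2 p2 x != 0%N by apply: contraNneq r2 => /= ->; rewrite run0.
have [t1 Tt1 Gt1] := Tx _ _ _ _ Tp dx1 dx2.
have [t2 Tt2 Gt2] := IH _ _ _ Tt1 r1 r2; exists t2 => //.
by have := GM _ _ Gt1 Gt2; rewrite word_elt_cons !mulgA mulgVK.
Qed.

(* The automaton is the restriction of the Schreier coset graph of H to the
   cosets of the prefixes of the generators. *)
Lemma exists_automaton (us : seq (word A)) :
  exists (d : nat -> letter A -> nat) (m : nat),
    [/\ inverse_automaton d, (forall p x, d p x <= m)%N,
        (forall u, u \in us -> foldl d 1%N u = 1%N) &
        forall w w', foldl d 1%N w != 0%N -> foldl d 1%N w = foldl d 1%N w' ->
          subgroup_of_words us (word_elt w * (word_elt w')^-1)].
Proof.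
set H := subgroup_of_words us.
(* All prefixes of the generators. Listing 1 first gives its coset the number 0, hence the base
   state 1. *)
pose V : seq (free_group A) :=
  1 :: [seq word_elt (take ku.1 ku.2) | ku <-
          [seq (k, u) | u <- us, k <- iota 0 (size u).+1]].
(* The number of the coset H g: the position of its first representative in [V], or [size V] when it
   has none. *)
pose c g := find (fun h => `[< H (g * h^-1) >]) V.
pose rep p := nth 1 V p.-1.
(* State p stands for the coset of the element of [V] at position p - 1, as 0 means undefined.
   Requiring [c (rep p) == p.-1] admits only the first representative, so each coset is a single
   state. *)
pose d p x :=
  if [&& p != 0, c (rep p) == p.-1 & c (rep p * letter_elt x)%g < size V]%N
  then (c (rep p * letter_elt x)%g).+1 else 0%N.
have H1: H 1 by apply: generated1.
have HM g h : H g -> H h -> H (g * h) by apply: generatedM.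
have HV g : H g -> H g^-1 by apply: generatedV.
have cH g h : H (g * h^-1) -> c g = c h.
  move=> Hgh; apply: eq_find => k; apply/asboolP/asboolP => Hk.
    by have := HM _ _ (HV _ Hgh) Hk; rewrite invgM invgK mulgA mulgVK.
  by have := HM _ _ Hgh Hk; rewrite mulgA mulgVK.
have Hc g : (c g < size V)%N -> H (g * (nth 1 V (c g))^-1).
  by rewrite -has_find => /(nth_find 1)/asboolP.
have c1: c 1 = 0%N.
  by rewrite /c /=; case: asboolP => //; rewrite invg1 mulg1.
have dP p x : d p x != 0%N ->
    [/\ p != 0, c (rep p) == p.-1 & c (rep p * letter_elt x)%g < size V]%N
    /\ d p x = (c (rep p * letter_elt x)).+1.
  by rewrite /d; case: ifP => // /and3P.
have d_rep p x : d p x != 0%N -> H (rep p * letter_elt x * (rep (d p x))^-1).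
  by move=> /dP[[_ _ /Hc Hr] ->].
exists d, (size V); split.
- move=> p x dpx; have [[p0 /eqP cp lt_c] dE] := dP _ _ dpx.
  have Hr := d_rep _ _ dpx; split=> //.
  rewrite [in LHS]/d dpx.
  have ->: c (rep (d p x)) = (d p x).-1 by rewrite -(cH _ _ Hr) dE.
  rewrite eqxx /= letter_eltV.
  have ->: c (rep (d p x) * (letter_elt x)^-1) = c (rep p).
    by apply: cH; have := HV _ Hr; rewrite !invgM !invgK !mulgA.
  (* Out of range, [rep p] would be the default 1, whose coset has number 0. This forces p - 1 = 0,
     a position that exists because [V] is not empty. *)
  suff lt_p: (p.-1 < size V)%N by rewrite cp lt_p prednK ?lt0n.
  rewrite ltnNge; apply/negP => le_p.
  by move: cp; rewrite /rep nth_default // c1 => p10; rewrite -p10 in le_p.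
- by move=> p x; rewrite /d; case: ifP => // /and3P[].
- move=> u us_u.
  have Spref k : (k <= size u)%N -> word_elt (take k u) \in V.
    move=> le_k; rewrite inE; apply/orP; right; apply/mapP; exists (k, u) => //.
    by apply/allpairsPdep; exists u, k; rewrite mem_iota.
  (* The cosets of all prefixes of [u] are states, so the run on [u] stays defined; it ends at the
     coset of [u], which is H itself. *)
  have run_pref k : (k <= size u)%N ->
      foldl d 1%N (take k u) = (c (word_elt (take k u))).+1.
    elim: k => [|k IH] lt_k; first by rewrite take0 word_elt_nil c1.
    have x : letter A by case: (u) lt_k.
    have cS g : g \in V -> (c g < size V)%N.
      move=> Vg; rewrite -has_find; apply/hasP; exists g => //.
      by apply/asboolP; rewrite mulgV.
    rewrite (take_nth x) // foldl_rcons IH 1?ltnW //.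
    set g := word_elt (take k u).
    have Hg: H (g * (rep (c g).+1)^-1) by apply/Hc/cS/Spref/ltnW.
    have cg: c (rep (c g).+1 * letter_elt (nth x u k)) = c (word_elt (take k.+1 u)).
      apply/esym/cH; rewrite (take_nth x) // -cats1 word_elt_cat.
      by rewrite word_elt_cons word_elt_nil mulg1 invgM mulgA mulgK.
    by rewrite /d cg -(cH _ _ Hg) eqxx cS ?Spref // -(take_nth x).
  rewrite -[u]take_size run_pref // take_size; congr _.+1; rewrite -c1; apply: cH.
  by rewrite invg1 mulg1; apply/generated_in/map_f.
(* A defined run on [w] ends in the state of the coset H w, so two words ending in the same state
   differ by an element of H. *)
- suff Hrun w : foldl d 1%N w != 0%N -> H (word_elt w * (rep (foldl d 1%N w))^-1).
    move=> w w' rw eq_r; have := HM _ _ (Hrun w rw) (HV _ (Hrun w' _)).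
    by rewrite -eq_r invgM invgK mulgA mulgVK; apply.
  elim/last_ind: w => [|w x IH] /=; first by rewrite word_elt_nil mulgV.
  rewrite foldl_rcons => dx; have [[rw _ _] _] := dP _ _ dx.
  have := HM _ _ (IH rw) (d_rep _ _ dx).
  by rewrite -cats1 word_elt_cat word_elt_cons word_elt_nil mulg1 !mulgA mulgVK.
Qed.

End Words.

(** * Certificates as coded data, and the recursiveness of their check *)

Lemma recursive_comp3 k g f1 f2 f3 :
    recursive 3 (fun t => g (nth 0 t 0) (nth 0 t 1) (nth 0 t 2)) ->
    recursive k f1 -> recursive k f2 -> recursive k f3 ->
  recursive k (fun s => g (f1 s) (f2 s) (f3 s)).
Proof.
move=> rg rf1 rf2 rf3; apply: (@recursive_comp _ 3 _ [:: f1; f2; f3] rg) => //.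
by do 3![apply: recursives_cons => //]; apply: recursives_nil.
Qed.

Lemma recursive_comp4 k g f1 f2 f3 f4 :
    recursive 4 (fun t => g (nth 0 t 0) (nth 0 t 1) (nth 0 t 2) (nth 0 t 3)) ->
    recursive k f1 -> recursive k f2 -> recursive k f3 -> recursive k f4 ->
  recursive k (fun s => g (f1 s) (f2 s) (f3 s) (f4 s)).
Proof.
move=> rg rf1 rf2 rf3 rf4.
apply: (@recursive_comp _ 4 _ [:: f1; f2; f3; f4] rg) => //.
by do 4![apply: recursives_cons => //]; apply: recursives_nil.
Qed.

Lemma recursive_size k l : recursivel k l -> recursive k (fun s => size (l s)).
Proof.
move=> rl; apply: (@eq_recursive _ (fun s => foldl (fun a _ => a.+1) 0 (l s))).
  move=> s; rewrite -[RHS]add0n.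
  by elim: (l s) 0 => [|x w IH] a /=; rewrite ?addn0 // IH addnS.
by apply: recursive_foldl; rec.
Qed.
#[export] Hint Resolve recursive_size : rec.
Hint Resolve recursiveb_all recursiveb_has : rec.

Section Certificate.
Variable inv : nat -> nat.
Variable N : nat.

(** The size test is there because the default head 0 of an empty list is also the code of a
    possible letter. *)
Definition push_code (x : nat) (w : seq nat) :=
  if (size w != 0) && (head 0 w == inv x) then behead w else x :: w.
Definition reduce_code (w : seq nat) := foldr push_code [::] w.
Definition winv_code (w : seq nat) := rev (map inv w).

(* A list of lists is a list of codes; missing entries read as 0 = code [::]. *)
Definition row (l : seq nat) i := decode (nth 0 l i).
Definition delta E p x := nth 0 (row E p) x.

(* The number 2 ^ a * (2 * b + 1) stands for u_a u_b^-1; an index which is out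
   of bounds denotes the empty word. *)
Definition expand us d :=
  foldl (fun w j => w ++ row us (head 0 (decode j))
                      ++ winv_code (row us (code (behead (decode j))))) [::] d.

(** A finite check suffices for the inverse automaton property: rows past the end of [E] read as 0,
    so such states have no transitions. *)
Definition accepts E us :=
  all (fun p => all (fun x => (delta E p x == 0) ||
                       (p != 0) && (delta E (delta E p x) (inv x) == p))
                (iota 0 N)) (iota 0 (size E))
  && all (fun i => foldl (delta E) 1 (row us i) == 1) (iota 0 (size us)).

(** Besides membership in the subgroup, the equality of codes forces the entries of [ws] to be codes
    of genuine words. *)
Definition derived us ws D :=
  all (fun i => nth 0 ws i == code (reduce_code (expand us (row D i))))
    (iota 0 (size ws)).

(* The entry of L at (p1, p2) is 0 when this vertex of the product automaton is
   not reached, and t + 1 when t codes a word leading to it. *)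
Definition schreier_word L p1 p2 x q1 q2 :=
  reduce_code (decode (delta L p1 p2).-1
                 ++ x :: winv_code (decode (delta L q1 q2).-1)).

Definition covers_edge ws L p1 p2 x q1 q2 :=
  [|| delta L p1 p2 == 0, q1 == 0, q2 == 0 |
    (delta L q1 q2 != 0) &&
    has (fun i => nth 0 ws i == code (schreier_word L p1 p2 x q1 q2))
      (iota 0 (size ws))].

(** The entry 1 at the base vertex is one more than the code 0 of the empty word. Vertices outside
    the table [L] read as not reached. *)
Definition covers E1 E2 L ws :=
  (delta L 1 1 == 1) &&
  all (fun p1 => all (fun p2 => all (fun x =>
      covers_edge ws L p1 p2 x (delta E1 p1 x) (delta E2 p2 x))
    (iota 0 N)) (iota 0 (size (row L p1)))) (iota 0 (size L)).

Definition certifies us vs c :=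
  [&& accepts (row c 0) us, accepts (row c 1) vs,
      covers (row c 0) (row c 1) (row c 2) (row c 3),
      derived us (row c 3) (row c 4) & derived vs (row c 3) (row c 5)].

Hypothesis rinv : recursive 1 (fun t => inv (nth 0 t 0)).

Lemma recursive_inv k f : recursive k f -> recursive k (fun s => inv (f s)).
Proof. exact: recursive_comp1. Qed.
Hint Resolve recursive_inv : rec.

Lemma recursive_delta k E p x : recursivel k E -> recursive k p -> recursive k x ->
  recursive k (fun s => delta (E s) (p s) (x s)).
Proof. by move=> rE rp rx; rewrite /delta /row; rec. Qed.
Hint Resolve recursive_delta : rec.

Lemma recursivel_row k l i : recursivel k l -> recursive k i ->
  recursivel k (fun s => row (l s) (i s)).
Proof. by move=> rl ri; rewrite /row; rec. Qed.
Hint Resolve recursivel_row : rec.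

Lemma recursivel_if k P f g : recursiveb k P -> recursivel k f ->
  recursivel k g -> recursivel k (fun s => if P s then f s else g s).
Proof.
move=> rP rf rg.
apply: (@eq_recursive _ (fun s => if P s then code (f s) else code (g s))).
  by move=> s; case: ifP.
exact: recursive_if.
Qed.
Hint Resolve recursivel_if : rec.

Lemma recursivel_reduce_code k w : recursivel k w ->
  recursivel k (fun s => reduce_code (w s)).
Proof. by move=> rw; apply: recursivel_foldr => //; rewrite /push_code; rec. Qed.
Hint Resolve recursivel_reduce_code : rec.

Lemma recursivel_winv_code k w : recursivel k w ->
  recursivel k (fun s => winv_code (w s)).
Proof.
move=> rw; apply: recursivel_rev.
by apply: (@recursivel_foldr _ (fun x w _ => inv x :: w) (fun=> [::])) => //; rec.
Qed.
Hint Resolve recursivel_winv_code : rec.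

Lemma recursivel_expand k us d : recursivel k us -> recursivel k d ->
  recursivel k (fun s => expand (us s) (d s)).
Proof.
move=> rus rd.
(* The parameters enter through their codes, which makes them variables of the environment of the
   loop body. The same device recurs below. *)
pose g u d := code (expand (decode u) (decode d)).
apply: (@eq_recursive _ (fun s => g (code (us s)) (code (d s)))).
  by move=> s; rewrite /g !CodeSeq.codeK.
apply: recursive_comp2 => //.
apply: (@recursivel_foldl _ (fun w j t =>
  w ++ row (decode (nth 0 t 0)) (head 0 (decode j))
    ++ winv_code (row (decode (nth 0 t 0)) (code (behead (decode j)))))); rec.
Qed.
Hint Resolve recursivel_expand : rec.

Lemma recursive_run k E p w : recursivel k E -> recursive k p -> recursivel k w ->
  recursive k (fun s => foldl (delta (E s)) (p s) (w s)).
Proof.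
move=> rE rp rw.
pose g E p w := foldl (delta (decode E)) p (decode w).
apply: (@eq_recursive _ (fun s => g (code (E s)) (p s) (code (w s)))).
  by move=> s; rewrite /g !CodeSeq.codeK.
apply: recursive_comp3 => //.
by apply: (@recursive_foldl _ (fun p x t => delta (decode (nth 0 t 0)) p x)); rec.
Qed.
Hint Resolve recursive_run : rec.

Lemma recursiveb_accepts k E us : recursivel k E -> recursivel k us ->
  recursiveb k (fun s => accepts (E s) (us s)).
Proof.
move=> rE rus; pose g E us : nat := accepts (decode E) (decode us).
apply: (@eq_recursive _ (fun s => g (code (E s)) (code (us s)))).
  by move=> s; rewrite /g !CodeSeq.codeK.
by apply: recursive_comp2 => //; apply: recursiveb_and; rec.
Qed.

Lemma recursiveb_derived k us ws D : recursivel k us -> recursivel k ws ->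
  recursivel k D -> recursiveb k (fun s => derived (us s) (ws s) (D s)).
Proof.
move=> rus rws rD.
pose g us ws D : nat := derived (decode us) (decode ws) (decode D).
apply: (@eq_recursive _ (fun s => g (code (us s)) (code (ws s)) (code (D s)))).
  by move=> s; rewrite /g !CodeSeq.codeK.
by apply: recursive_comp3 => //; apply: recursiveb_all; rec.
Qed.

Lemma recursiveb_covers k E1 E2 L ws : recursivel k E1 -> recursivel k E2 ->
    recursivel k L -> recursivel k ws ->
  recursiveb k (fun s => covers (E1 s) (E2 s) (L s) (ws s)).
Proof.
move=> rE1 rE2 rL rws.
pose g E1 E2 L ws : nat := covers (decode E1) (decode E2) (decode L) (decode ws).
apply: (@eq_recursive _
  (fun s => g (code (E1 s)) (code (E2 s)) (code (L s)) (code (ws s)))).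
  by move=> s; rewrite /g !CodeSeq.codeK.
apply: recursive_comp4 => //.
rewrite /g /covers; apply: (@recursiveb_and 4); first by rec.
do 3![apply: recursiveb_all; first by rec].
by rewrite /covers_edge /schreier_word; rec.
Qed.
Hint Resolve recursiveb_accepts recursiveb_derived recursiveb_covers : rec.

Lemma recursiveb_certifies :
  recursiveb 3 (fun t => certifies (decode (nth 0 t 1)) (decode (nth 0 t 2))
                           (decode (nth 0 t 0))).
Proof. by rewrite /certifies; rec. Qed.

End Certificate.

Lemma map_surj (T T' : Type) (f : T -> T') (s : seq T') (x0 : T') :
  (forall i, i < size s -> exists x, nth x0 s i = f x) -> exists t, s = map f t.
Proof.
elim: s => [|y s IH] sP; first by exists [::].
have [x xP] := sP 0 isT; have [|t ->] := IH; first by move=> i; apply: (sP i.+1).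
by exists (x :: t); rewrite /= -xP.
Qed.

Lemma foldl_map (T T' R : Type) (h : T -> T') (f : R -> T' -> R) z s :
  foldl f z (map h s) = foldl (fun a x => f a (h x)) z s.
Proof. by elim: s z => /=. Qed.

(** * Codes interpreted in the free group *)

Section Correctness.
Variable A : finType.
Implicit Types (x : letter A) (u v w : word A) (g h : free_group A).
Implicit Types (us vs ws : seq (word A)).

Definition inv_letter_code k : nat :=
  if [pick x : A + A | code_letter x == k] is Some x then code_letter (linv x)
  else k.

(** A number that codes no letter is fixed by [inv] and read as 1. Both choices agree with
    inversion, so the table [L] of a certificate may contain arbitrary numbers. *)
Definition letter_value k : free_group A :=
  if [pick x : A + A | code_letter x == k] is Some x then letter_elt x else 1%g.

Definition word_value (s : seq nat) : free_group A :=
  (\prod_(k <- s) letter_value k)%g.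

Local Notation inv := inv_letter_code.
Local Notation N := #|{: A + A}|.

Lemma code_letter_inj : injective (@code_letter A).
Proof. by move=> x y /ord_inj/enum_rank_inj. Qed.

Lemma code_word_inj : injective (@code_word A).
Proof. by move=> u v /(can_inj CodeSeq.codeK)/(inj_map code_letter_inj). Qed.

Lemma ltn_code_letter x : code_letter x < N.
Proof. exact: ltn_ord. Qed.

Lemma code_letter_surj k : k < N -> exists x, k = code_letter x.
Proof.
by move=> lt_k; exists (enum_val (Ordinal lt_k)); rewrite /code_letter enum_valK.
Qed.

Lemma pick_code_letter x :
  [pick y : A + A | code_letter y == code_letter x] = Some x.
Proof. by case: pickP => [y /eqP/code_letter_inj-> // | /(_ x)/eqP]. Qed.

Lemma inv_code_letter x : inv (code_letter x) = code_letter (linv x).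
Proof. by rewrite /inv pick_code_letter. Qed.

Lemma letter_value_code x : letter_value (code_letter x) = letter_elt x.
Proof. by rewrite /letter_value pick_code_letter. Qed.

Lemma recursive_inv_letter_code : recursive 1 (fun t => inv (nth 0 t 0)).
Proof.
apply: (@recursive_finite_support N) => k le_k; rewrite /inv.
by case: pickP => // x /eqP xk; rewrite -xk leqNgt ltn_code_letter in le_k.
Qed.

Lemma letter_valueV k : letter_value (inv k) = ((letter_value k)^-1)%g.
Proof.
case: (boolP [exists x : A + A, code_letter x == k]) => [/existsP[x /eqP<-]|no_x].
  by rewrite inv_code_letter !letter_value_code letter_eltV.
have pickN: [pick x : A + A | code_letter x == k] = None.
  by case: pickP => // x xk; case/existsP: no_x; exists x.
by rewrite /letter_value /inv !pickN invg1.
Qed.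

Lemma word_value_code w : word_value (map (@code_letter A) w) = word_elt w.
Proof.
rewrite /word_value big_map; apply: eq_bigr => x _; exact: letter_value_code.
Qed.

Lemma word_value_cat s t : word_value (s ++ t) = (word_value s * word_value t)%g.
Proof. exact: big_cat. Qed.

Lemma word_value_cons k s :
  word_value (k :: s) = (letter_value k * word_value s)%g.
Proof. exact: big_cons. Qed.

Lemma word_valueV s : word_value (winv_code inv s) = ((word_value s)^-1)%g.
Proof.
elim: s => [|k s IH]; first by rewrite /word_value big_nil invg1.
rewrite /winv_code map_cons rev_cons -cats1 word_value_cat [word_value (rev _)]IH.
by rewrite !word_value_cons {2}/word_value big_nil mulg1 letter_valueV invgM.
Qed.

Lemma word_value_push k s :
  word_value (push_code inv k s) = (letter_value k * word_value s)%g.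
Proof.
rewrite /push_code; case: s => [|l s] /=; first by rewrite word_value_cons.
by case: eqP => [->|_]; rewrite !word_value_cons // letter_valueV mulVKg.
Qed.

Lemma word_value_reduce s : word_value (reduce_code inv s) = word_value s.
Proof. by elim: s => //= k s IH; rewrite word_value_push IH word_value_cons. Qed.

Lemma reduce_code_word w :
  reduce_code inv (map (@code_letter A) w) = map (@code_letter A) (reduce w).
Proof.
elim: w => //= x w ->; rewrite /push_code /push; case: (reduce w) => //= y v.
by rewrite inv_code_letter (inj_eq code_letter_inj); case: ifP.
Qed.

Lemma winv_code_word w :
  winv_code inv (map (@code_letter A) w) = map (@code_letter A) (winv w).
Proof.
rewrite /winv_code /winv -map_comp map_rev -map_comp; congr rev.
by apply: eq_map => x; apply: inv_code_letter.
Qed.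

Lemma row_words (us : seq (word A)) i :
  row (map (@code_word A) us) i = map (@code_letter A) (nth [::] us i).
Proof.
case: (ltnP i (size us)) => [lt_i | le_i].
  by rewrite /row (nth_map [::]) // CodeSeq.codeK.
by rewrite /row !nth_default ?size_map.
Qed.

Lemma subgroup_nth us i : subgroup_of_words us (word_elt (nth [::] us i)).
Proof.
case: (ltnP i (size us)) => [lt_i | le_i].
  by apply: generated_in; apply: map_f; apply: mem_nth.
by rewrite nth_default // word_elt_nil; apply: generated1.
Qed.

Definition expand_words (us : seq (word A)) (d : seq nat) : word A :=
  flatten [seq nth [::] us (head 0 (decode j)) ++
               winv (nth [::] us (code (behead (decode j)))) | j <- d].

Lemma expand_code us d :
  expand inv (map (@code_word A) us) d = map (@code_letter A) (expand_words us d).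
Proof.
rewrite /expand -[RHS]cat0s; elim: d [::] => [|j d IH] w /=; first by rewrite cats0.
by rewrite IH !row_words winv_code_word -map_cat [in RHS]map_cat catA.
Qed.

Lemma subgroup_expand us d : subgroup_of_words us (word_elt (expand_words us d)).
Proof.
rewrite /expand_words; elim: d => [|j d IH] /=.
  by rewrite word_elt_nil; apply: generated1.
rewrite !word_elt_cat word_eltV; apply: generatedM IH.
by apply: generatedM; [|apply: generatedV]; apply: subgroup_nth.
Qed.

(** A generator is u_a u_b^-1 with b out of bounds, a product is a concatenation, and an inverse
    reverses the list and swaps the two indices of each pair. *)
Lemma expand_surj us g : subgroup_of_words us g ->
  exists d, g = word_elt (expand_words us d).
Proof.
pose pair a b := code (a :: decode b).
have consE j d : word_elt (expand_words us (j :: d)) =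
    (word_elt (nth [::] us (head 0 (decode j)))
       * (word_elt (nth [::] us (code (behead (decode j)))))^-1
       * word_elt (expand_words us d))%g.
  by rewrite /expand_words /= !word_elt_cat word_eltV.
have pairE a b d : word_elt (expand_words us (pair a b :: d)) =
    (word_elt (nth [::] us a) * (word_elt (nth [::] us b))^-1
       * word_elt (expand_words us d))%g.
  by rewrite consE CodeSeq.codeK /= CodeSeq.decodeK.
have catE d e : word_elt (expand_words us (d ++ e)) =
    (word_elt (expand_words us d) * word_elt (expand_words us e))%g.
  by rewrite /expand_words map_cat flatten_cat word_elt_cat.
have nilE: word_elt (expand_words us [::]) = 1%g by apply: (word_elt_nil A).
elim=> [_ /mapP[u us_u ->]||_ _ _ [d ->] _ [e ->]|_ _ [d ->]].
- exists [:: pair (index u us) (size us)].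
  by rewrite pairE nilE nth_index // nth_default // word_elt_nil invg1 !mulg1.
- by exists [::]; rewrite nilE.
- by exists (d ++ e); rewrite catE.
elim: d => [|j d [e IH]]; first by exists [::]; rewrite nilE invg1.
exists (e ++ [:: pair (code (behead (decode j))) (head 0 (decode j))]).
by rewrite consE catE -IH pairE nilE mulg1 !invgM invgK.
Qed.

Lemma subgroup_min us (G : free_group A -> Prop) : G 1%g ->
    (forall g h, G g -> G h -> G (g * h)%g) -> (forall g, G g -> G (g^-1)%g) ->
    (forall u, u \in us -> G (word_elt u)) ->
  forall g, subgroup_of_words us g -> G g.
Proof.
move=> G1 GM GV Gus g.
by elim=> [_ /mapP[u us_u ->]||h k _ Gh _ Gk|h _ Gh]; auto.
Qed.

Lemma delta_neq0 E p k : delta E p k != 0 -> p < size E.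
Proof.
move=> dk; rewrite ltnNge; apply: contra_neqN dk => le_p.
by rewrite /delta /row (nth_default _ le_p) nth_default.
Qed.

(** * Soundness of certificates *)

Section Soundness.
Variables (us : seq (word A)) (E : seq nat).
Hypothesis E_us : accepts inv N E (map (@code_word A) us).

Definition transition (E : seq nat) p x := delta E p (code_letter x).

Lemma transition_inverse : inverse_automaton (transition E).
Proof.
move=> p x; rewrite /transition => dx.
have lt_p: p < size E.
  exact: delta_neq0 dx.
case/andP: E_us => /allP/(_ p); rewrite mem_iota => /(_ lt_p).
move/allP/(_ (code_letter x)).
rewrite mem_iota => /(_ (ltn_code_letter x)).
by rewrite (negPf dx) inv_code_letter => /andP[p0 /eqP dK] _.
Qed.

Lemma accepts_run g :
  subgroup_of_words us g -> foldl (transition E) 1 (fgval g) = 1.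
Proof.
apply: run_generated transition_inverse _ _ _ => u us_u.
case/andP: E_us => _ /allP/(_ (index u us)).
rewrite mem_iota size_map index_mem us_u => /(_ isT)/eqP.
by rewrite row_words nth_index // foldl_map.
Qed.

Lemma derived_words (ws D : seq nat) :
    derived inv (map (@code_word A) us) ws D ->
  forall i, i < size ws ->
  exists w, nth 0 ws i = code_word w /\ subgroup_of_words us (word_elt w).
Proof.
move=> /allP wsP i lt_i; exists (reduce (expand_words us (row D i))).
move/(_ i): wsP; rewrite mem_iota => /(_ lt_i)/eqP->.
rewrite expand_code reduce_code_word -fgval_word_elt word_eltK; split=> //.
exact: subgroup_expand.
Qed.

End Soundness.

(** The derivations put the words [ws] into both subgroups. Conversely, the reduced word of an
    element of both is a loop in both automata, so [product_generated] applies. *)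
Lemma certifies_sound us vs c :
    certifies inv N (map (@code_word A) us) (map (@code_word A) vs) c ->
  exists ws, row c 3 = map (@code_word A) ws /\
    forall g, (subgroup_of_words us g /\ subgroup_of_words vs g)
              <-> subgroup_of_words ws g.
Proof.
case/and5P; set E1 := row c 0; set E2 := row c 1; set L := row c 2.
move=> E1P E2P /andP[/eqP L1 LP] D1P D2P.
have [|ws wsE] := @map_surj _ _ (@code_word A) (row c 3) 0.
  by move=> i /(derived_words D1P)[w [-> _]]; exists w.
exists ws; split=> // g; split=> [[Hg Kg]|]; last first.
  have sub us' D : derived inv (map (@code_word A) us') (row c 3) D ->
      subgroup_of_words ws g -> subgroup_of_words us' g.
    move=> DP; apply: subgroup_min => [|h k|h|w ws_w].
    - exact: generated1.
    - exact: generatedM.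
    - exact: generatedV.
    have [|w' [eq_w]] := derived_words DP (i := index w ws).
      by rewrite wsE size_map index_mem.
    move: eq_w; rewrite wsE (nth_map [::]) ?index_mem // nth_index //.
    by move/code_word_inj->.
  by move=> Wg; split; [apply: sub D1P Wg | apply: sub D2P Wg].
pose T p1 p2 :=
  if delta L p1 p2 is t.+1 then Some (word_value (decode t)) else None.
rewrite -[g]word_eltK.
apply: (@product_generated _ (transition E1) (transition E2) T
          (subgroup_of_words ws)).
- exact: transition_inverse E1P.
- exact: transition_inverse E2P.
- exact: generated1.
- by move=> h k; apply: generatedM.
- by rewrite /T L1 /word_value big_nil.
- move=> p1 p2 x t Tp d1 d2.
  have Lp: delta L p1 p2 != 0 by apply: contra_eq_neq Tp; rewrite /T => ->.
  have lt_p1: p1 < size L.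
    exact: delta_neq0 Lp.
  have lt_p2: p2 < size (row L p1).
    by rewrite ltnNge; apply: contra_neqN Lp => le_p; rewrite /delta nth_default.
  have := LP; move/allP/(_ p1); rewrite mem_iota => /(_ lt_p1).
  move/allP/(_ p2); rewrite mem_iota => /(_ lt_p2).
  move/allP/(_ (code_letter x)); rewrite mem_iota => /(_ (ltn_code_letter x)).
  rewrite /covers_edge -/(transition E1 p1 x) -/(transition E2 p2 x).
  rewrite (negPf Lp) (negPf d1) (negPf d2) /= => /andP[Lq /hasP[i]].
  rewrite mem_iota wsE size_map => lt_i /eqP.
  rewrite (nth_map [::]) // => /(can_inj CodeSeq.codeK) wiE.
  (* The certificate compares reduced words; their values give the identity in the free group. *)
  have := congr1 word_value wiE.
  rewrite word_value_code word_value_reduce word_value_cat word_value_cons.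
  rewrite word_valueV letter_value_code.
  move: Tp Lq; rewrite /T; case: (delta L p1 p2) => // t1 [<-].
  case: (delta L _ _) => // t2 _ wiE'; exists (word_value (decode t2)) => //.
  by rewrite -mulgA -wiE'; apply: subgroup_nth.
- exact: accepts_run E1P _ Hg.
- exact: accepts_run E2P _ Kg.
Qed.

(** * Existence of certificates *)

Definition table m n (f : nat -> nat -> nat) : seq nat :=
  mkseq (fun i => code (mkseq (f i) n)) m.

Lemma delta_table m n f i j :
  delta (table m n f) i j = if (i < m) && (j < n) then f i j else 0.
Proof.
rewrite /delta /row /table; case: ltnP => [lt_im | le_mi] /=; last first.
  by rewrite (nth_default _ (s := mkseq _ _)) ?size_mkseq // nth_default.
rewrite nth_mkseq // CodeSeq.codeK; case: ltnP => [lt_jn | le_nj].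
  by rewrite nth_mkseq.
by rewrite nth_default ?size_mkseq.
Qed.

Definition automaton_code (d : nat -> letter A -> nat) m : seq nat :=
  table m.+1 N (fun p k =>
    if [pick x : A + A | code_letter x == k] is Some x then d p x else 0).

(** The table stops at state m, but a state with a defined transition is the target of the inverse
    transition and so is at most m. *)
Lemma delta_automaton d m p x : inverse_automaton d -> (forall p x, d p x <= m) ->
  delta (automaton_code d m) p (code_letter x) = d p x.
Proof.
move=> d_inv le_dm; rewrite delta_table ltn_code_letter andbT pick_code_letter.
case: ltnP => // lt_mp; apply/esym/eqP; apply: contraTT lt_mp => dx.
by have [_ <-] := d_inv _ _ dx; rewrite -leqNgt.
Qed.

Lemma accepts_automaton d m us :
    inverse_automaton d -> (forall p x, d p x <= m) ->
    (forall u, u \in us -> foldl d 1 u = 1) ->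
  accepts inv N (automaton_code d m) (map (@code_word A) us).
Proof.
move=> d_inv le_dm loop.
apply/andP; split; apply/allP => p; rewrite mem_iota => lt_p.
  apply/allP => k; rewrite mem_iota => /code_letter_surj[x ->].
  rewrite inv_code_letter !delta_automaton //; case: eqVneq => //= dx.
  by have [-> ->] := d_inv _ _ dx; rewrite eqxx.
rewrite row_words foldl_map; rewrite size_map in lt_p.
rewrite -[X in _ == X](loop _ (mem_nth [::] lt_p)); apply/eqP.
by elim: (nth _ us p) 1 => //= x u IH q; rewrite delta_automaton.
Qed.

(** The Schreier graphs give [E1] and [E2], reachability in their product gives [L], and [ws] lists
    the finitely many words t_p x t_q^-1 of edges at reached vertices. *)
Lemma certifies_complete us vs : exists c : seq nat,
  certifies inv N (map (@code_word A) us) (map (@code_word A) vs) c.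
Proof.
have [d1 [m1 [d1_inv le_d1 loop1 d1H]]] := exists_automaton us.
have [d2 [m2 [d2_inv le_d2 loop2 d2K]]] := exists_automaton vs.
pose reach w p := foldl d1 1 w = p.1 /\ foldl d2 1 w = p.2.
pose rep p t := ((exists w, reach w p) -> t != 0) /\
                (t != 0 -> exists2 w, t = (code_word w).+1 & reach w p).
(* By classical reasoning, a reachable vertex gets one more than the code of some word leading to
   it, and any other vertex gets 0. The base vertex gets the empty word. *)
have /choice[T TP]: forall p, exists t, rep p t /\ (p = (1, 1) -> t = 1).
  move=> p.
  case: (eqVneq p (1, 1)) => [-> | /eqP p1].
    by exists 1; split=> //; split=> // _; exists [::].
  have [[w rw] | no_w] := pselect (exists w, reach w p).
    by exists (code_word w).+1; split=> //; split=> // _; exists w.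
  by exists 0; split=> //; split.
(* States go up to m, and the base state 1 needs an entry even if m = 0, hence the size m + 2. *)
pose L := table m1.+2 m2.+2 (fun p1 p2 => T (p1, p2)).
pose E1 := automaton_code d1 m1; pose E2 := automaton_code d2 m2.
pose edge (e : 'I_m1.+2 * 'I_m2.+2 * (A + A)) :=
  let: (p1, p2, x) := e in
  schreier_word inv L p1 p2 (code_letter x) (d1 p1 x) (d2 p2 x).
pose live (e : 'I_m1.+2 * 'I_m2.+2 * (A + A)) :=
  let: (p1, p2, x) := e in
  [&& T (p1 : nat, p2 : nat) != 0, d1 p1 x != 0 & d2 p2 x != 0].
have LT p1 p2 : p1 < m1.+2 -> p2 < m2.+2 -> delta L p1 p2 = T (p1, p2).
  by move=> lt1 lt2; rewrite delta_table lt1 lt2.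
have LTd p1 p2 x : delta L (d1 p1 x) (d2 p2 x) = T (d1 p1 x, d2 p2 x).
  by apply: LT; rewrite !ltnS leqW ?le_d1 ?le_d2.
(* Take w = t_p x t_q^-1: the words t_p x and t_q lead to the same state in each automaton, hence
   differ by an element of each subgroup. *)
have edgeP e : live e -> exists w, [/\ edge e = map (@code_letter A) (reduce w),
    subgroup_of_words us (word_elt w) & subgroup_of_words vs (word_elt w)].
  case: e => [[p1 p2] x] /and3P[Tp dx1 dx2].
  have [[_ /(_ Tp)[w Tw [r1 r2]]] _] := TP (p1 : nat, p2 : nat).
  have rq: exists w', reach w' (d1 p1 x, d2 p2 x).
    by exists (rcons w x); rewrite /reach /= !foldl_rcons r1 r2.
  have [[/(_ rq) Tq /(_ Tq)[w' Tw' [r1' r2']]] _] := TP (d1 p1 x, d2 p2 x).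
  exists (w ++ x :: winv w'); split.
  - rewrite /edge /schreier_word LTd (LT _ _ (ltn_ord p1) (ltn_ord p2)) Tw Tw' /=.
    by rewrite !CodeSeq.codeK winv_code_word -map_cons -map_cat reduce_code_word.
  - have := d1H (rcons w x) w'; rewrite foldl_rcons r1 r1' => /(_ dx1 erefl).
    rewrite -cats1 !word_elt_cat !word_elt_cons word_elt_nil word_eltV mulg1.
    by rewrite mulgA.
  - have := d2K (rcons w x) w'; rewrite foldl_rcons r2 r2' => /(_ dx2 erefl).
    rewrite -cats1 !word_elt_cat !word_elt_cons word_elt_nil word_eltV mulg1.
    by rewrite mulgA.
pose ws := [seq code (edge e) | e <- enum live].
have derivedP us' : (forall e, live e -> exists w,
      edge e = map (@code_letter A) (reduce w) /\
      subgroup_of_words us' (word_elt w)) ->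
    exists D, derived inv (map (@code_word A) us') ws D.
  move=> edgeP'.
  have: forall e, exists d, live e ->
      edge e = reduce_code inv (expand inv (map (@code_word A) us') (decode d)).
    move=> e; case: (boolP (live e)) => [|_]; last by exists 0.
    (* The derivation and [w] denote the same element, so their reduced words, which [derived]
       compares, coincide. *)
    case/edgeP' => w [-> /expand_surj[d wE]].
    exists (code d) => _; rewrite CodeSeq.codeK expand_code reduce_code_word.
    by rewrite -!fgval_word_elt wE.
  case/choice => F FP; exists [seq F e | e <- enum live].
  apply/allP => i; rewrite mem_iota /= add0n size_map => lt_i.
  have e0 : 'I_m1.+2 * 'I_m2.+2 * (A + A) by case: (enum live) lt_i.
  rewrite /row !(nth_map e0) // -FP //.
  by have := mem_nth e0 lt_i; rewrite mem_enum.
have [D1 D1P]: exists D, derived inv (map (@code_word A) us) ws D.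
  by apply: derivedP => e /edgeP[w [eE Hw _]]; exists w.
have [D2 D2P]: exists D, derived inv (map (@code_word A) vs) ws D.
  by apply: derivedP => e /edgeP[w [eE _ Kw]]; exists w.
have A1 := accepts_automaton d1_inv le_d1 loop1.
have A2 := accepts_automaton d2_inv le_d2 loop2.
exists (map code [:: E1; E2; L; ws; D1; D2]).
have rowE i : i < 6 -> row (map code [:: E1; E2; L; ws; D1; D2]) i
    = nth [::] [:: E1; E2; L; ws; D1; D2] i.
  by move=> lt_i; rewrite /row (nth_map [::]) // CodeSeq.codeK.
rewrite /certifies !rowE //.
apply/and5P; split=> //.
apply/andP; split; first by rewrite LT //; have [_ /(_ erefl)->] := TP (1, 1).
apply/allP => p1; rewrite mem_iota size_mkseq => lt1.
apply/allP => p2; rewrite mem_iota => lt2.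
apply/allP => k; rewrite mem_iota => /code_letter_surj[x ->].
have {}lt2: p2 < m2.+2.
  by move: lt2; rewrite /row nth_mkseq // CodeSeq.codeK size_mkseq.
rewrite /covers_edge /E1 /E2 !delta_automaton // LT //.
have [//|Tp] := eqVneq; have [//|dx1] := eqVneq; have [//|dx2] /= := eqVneq.
pose e : 'I_m1.+2 * 'I_m2.+2 * (A + A) := (Ordinal lt1, Ordinal lt2, x).
have live_e : live e by rewrite /live /= Tp dx1.
have [[_ /(_ Tp)[w Tw [r1 r2]]] _] := TP (p1, p2).
(* Appending x to the word of the start reaches the end of the edge, so its label is nonzero. *)
have rq: exists w', reach w' (d1 p1 x, d2 p2 x).
  by exists (rcons w x); rewrite /reach /= !foldl_rcons r1 r2.
have [[/(_ rq) Tq _] _] := TP (d1 p1 x, d2 p2 x).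
rewrite LTd Tq; apply/hasP; exists (index e (enum live)).
  by rewrite mem_iota /= add0n size_map index_mem mem_enum.
by rewrite (nth_map e) ?index_mem ?mem_enum // nth_index ?mem_enum.
Qed.

End Correctness.

(** * The search for the least certificate *)

Theorem mainTheorem4 (A : finType) :
  exists f : seq (word A) -> seq (word A) -> option (seq (word A)),
    computable f /\
    forall us vs : seq (word A),
      let H : free_group A -> Prop :=
        fun x => subgroup_of_words us x /\ subgroup_of_words vs x in
      (isSome (f us vs) <-> finitely_generated H) /\
      (forall ws : seq (word A), f us vs = Some ws ->
         forall x : free_group A, H x <-> subgroup_of_words ws x).
Proof.
pose check us vs c := certifies (@inv_letter_code A) #|{: A + A}|
  (decode us) (decode vs) (decode c).
have [q eq_q] : recursive 3
    (fun t => ~~ check (nth 0 t 1) (nth 0 t 2) (nth 0 t 0)).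
  apply: recursiveb_neg; apply: recursiveb_certifies.
  exact: recursive_inv_letter_code.
have [r eq_r] : recursive 1 (fun t => (nth 0 (decode (nth 0 t 0)) 3).+1).
  by rec.
(* [q] vanishes exactly on certificates, so [Mu q] finds the least one; [r] takes its entry 3, the
   code of [ws], and adds 1 as [code_output] does for [Some]. *)
pose p := Comp r [:: Mu q].
have fP (uv : seq (word A) * seq (word A)) : exists ws,
    eval p [:: code_words uv.1; code_words uv.2] (code_words ws).+1 /\
    forall x, subgroup_of_words uv.1 x /\ subgroup_of_words uv.2 x
              <-> subgroup_of_words ws x.
  case: uv => us vs /=.
  have ex_c: exists c, check (code_words us) (code_words vs) c.
    have [c cP] := certifies_complete us vs.
    by exists (code c); rewrite /check !CodeSeq.codeK.
  have [c cP c_min] := ex_minnP ex_c.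
  have := cP; rewrite /check /code_words !CodeSeq.codeK.
  case/certifies_sound => ws [wsE wsP]; exists ws; split=> //.
  apply: (@eval_Comp _ _ _ [:: c]).
    constructor; last exact: evals_nil.
    (* Below the minimum [q] returns 1, the successor of the constant 0 given here. *)
    apply: (@eval_Mu _ _ _ (fun=> 0)).
      by have := eq_q [:: c; code_words us; code_words vs] erefl; rewrite /= cP.
    move=> i lt_ic; have := eq_q [:: i; code_words us; code_words vs] erefl.
    by rewrite /=; case: (boolP (check _ _ i)) => // /c_min; rewrite leqNgt lt_ic.
  have := eq_r [:: c] erefl.
  by rewrite /= /code_words -wsE /row CodeSeq.decodeK.
have [f fE] := choice fP.
exists (fun us vs => Some (f (us, vs))); split.
  by exists p => us vs; have [] := fE (us, vs).
move=> us vs H; have [_ fH] := fE (us, vs); split; last by move=> ws [<-].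
(* [f] never returns [None], and the words found witness that the intersection is finitely
   generated. *)
by split=> // _; exists (map (@word_elt A) (f (us, vs))).
Qed.
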